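(* For every integer $m\ge 2$, $$\delta^{\mathrm{rk}}_{m-1}(m,m,2;2)=\frac{1}{2}\cdot\frac{2^{m^2}\,\varphi(m)\,\prod_{j=1}^m\left(1-\frac{1}{2^j}\right)(2^{2m}-1)}{(2^{m^2}-1)(2^{m^2-m}-1)},$$ where $\varphi$ is Euler's totient function, and $$\delta^{\mathrm{rk}}_{m-1}(m,m,2;2)\in\mathcal{O}\left(m2^{-m^2+3m}\right)\quad\text{as } m\to+\infty.$$
   Context: Let $q$ be a prime power. The rank $\mathrm{rk}(v)$ of $v\in\mathbb{F}_{q^m}^n$ is the dimension over $\mathbb{F}_q$ of the $\mathbb{F}_q$-span of its entries. For a nonzero $\mathbb{F}_{q^m}$-linear subspace $\mathcal{C}\le\mathbb{F}_{q^m}^n$ (a rank-metric code), its minimum distance is $d^{\mathrm{rk}}(\mathcal{C})=\min\{\mathrm{rk}(v): v\in\mathcal{C},\ v\ne 0\}$. The density function is $$\delta^{\mathrm{rk}}_d(m,n,k;q)=\frac{|\{\mathcal{C}\le\mathbb{F}_{q^m}^n : \mathcal{C}\ \mathbb{F}_{q^m}\text{-linear},\ \dim_{\mathbb{F}_{q^m}}(\mathcal{C})=k,\ d^{\mathrm{rk}}(\mathcal{C})\ge d\}|}{\begin{bmatrix}n\\k\end{bmatrix}_{q^m}},$$ where $\begin{bmatrix}n\\k\end{bmatrix}_{q^m}$ is the Gaussian binomial coefficient, i.e. the number of $k$-dimensional $\mathbb{F}_{q^m}$-subspaces of $\mathbb{F}_{q^m}^n$. *)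

(* Defs.v *)
From HB Require Import structures.
From mathcomp Require Import all_boot all_order all_algebra all_field.
From mathcomp Require Import all_classical all_reals all_analysis.

Set Implicit Arguments.
Unset Strict Implicit.
Unset Printing Implicit Defensive.

Import Order.TTheory GRing.Theory Num.Theory.
Local Open Scope ring_scope.

(* A subspace is determined by its canonical basis matrix, so a vector space
   over a finite field has finitely many subspaces. *)
HB.instance Definition _ (K : finFieldType) (vT : vectType K) :=
  Choice_isCountable.Build {vspace vT}
    (pcan_pickleK (can_pcan (@VectorInternalTheory.vs2mxK K vT))).
HB.instance Definition _ (K : finFieldType) (vT : vectType K) :=
  fintype.isFinite.Build {vspace vT}
    (pcan_enumP (can_pcan (@VectorInternalTheory.vs2mxK K vT))).

(* F stands for F_q with q = #|F|, and L for F_(q^m) with m = \dim {:L} over F.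
   Codes are L-subspaces of L^n; finvect_type L is L itself, equipped with its
   finite field structure. *)
Definition rank_code (F : finFieldType) (L : fieldExtType F) (n : nat) :=
  {vspace 'rV[finvect_type L]_n}.

Definition rk (F : finFieldType) (L : fieldExtType F) (n : nat)
    (v : 'rV[finvect_type L]_n) : nat :=
  \dim <<[seq (v ord0 i : L) | i : 'I_n]>>.

(* Ranks in L^n never exceed n, so the default value n of the iterated minimum
   does not affect the result for C <> 0. For C = 0 the value is n by
   convention. *)
Definition min_distance (F : finFieldType) (L : fieldExtType F) (n : nat)
    (C : rank_code L n) : nat :=
  \big[minn/n]_(v : 'rV[finvect_type L]_n | (v \in C) && (v != 0)) rk v.

(* The Gaussian binomial coefficient with base #|K|, defined by what it counts. *)
Definition gaussian_binomial (K : finFieldType) (n k : nat) : nat :=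
  #|[set C : {vspace 'rV[K]_n} | \dim C == k]|.

Definition density (R : realType) (F : finFieldType) (L : fieldExtType F)
    (d n k : nat) : R :=
  #|[set C : rank_code L n
    | (\dim C == k) && (d <= min_distance C)%N]|%:R
  / (gaussian_binomial (finvect_type L) n k)%:R.

(* Main.v *)
Require Import Defs.
From HB Require Import structures.
From mathcomp Require Import all_classical all_reals all_analysis.
From mathcomp Require Import all_boot all_order all_algebra all_field.
From mathcomp Require Import fingroup perm mxabelem.
From mathcomp Require Import ring lra zify.

Set Implicit Arguments.
Unset Strict Implicit.
Unset Printing Implicit Defensive.

Import Order.TTheory GRing.Theory Num.Theory numFieldNormedType.Exports.
Local Open Scope ring_scope.

(** Let Q = 2^m and call a 2-dimensional code MRD when its minimum distance is at
    least m - 1. Count pairs (C, g) with C an MRD code and g in C a word of rank m.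

    For nonzero x in F_2^m the words of C with c . x = 0 form a line, and a
    nonzero word is annihilated by at most one nonzero x, so C has (Q - 1)^2 words
    of rank m - 1, hence 2(Q - 1) words of rank m. Conversely a word g of rank m
    lies in exactly phi(m) MRD codes, the Gabidulin codes <g, g^(2^i)> with i coprime
    to m. There are |GL_m(2)| words of rank m, whence the number of MRD codes.

    The determination of the codes through g is Payne's theorem on translation
    o-polynomials. A second basis vector is h = f(g) with f(x) = sum_i c_i x^(2^i),
    and the MRD condition says that x |-> f(x)/x is injective on nonzero x. It omits one
    value a0; replacing f by f - a0 x, the equation f(x) = a x has a
    nonzero solution for every a <> 0. With D the Dickson matrix of f,
    det (D + diag (a^(2^k))_k) then vanishes for all a <> 0. Its coefficients as a polynomial
    in a of degree Q - 1 are the principal minors of D (binary expansions make the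
    exponents distinct), so it equals a^(Q-1) - 1: the proper principal minors vanish
    and det D <> 0. A shortest cycle in the digraph of
    nonzero entries of D is chordless, so the principal minor on its vertices is
    nonzero, and the digraph is a single Hamiltonian cycle. Since D is
    circulant up to Frobenius powers, exactly one c_i is nonzero, with i coprime to m. *)

(** * Binary expansions indexed by subsets *)

Section BinaryWeight.

Lemma binary_sum_inj n (f g : nat -> bool) :
  (\sum_(i < n) f i * 2 ^ i = \sum_(i < n) g i * 2 ^ i)%N ->
  forall i, (i < n)%N -> f i = g i.
Proof.
elim: n f g => [|n IHn] f g //.
rewrite !big_ord_recl /= !muln1.
under eq_bigr => i _ do rewrite expnS mulnCA.
under [X in (_ = _ + X)%N -> _]eq_bigr => i _ do rewrite expnS mulnCA.
rewrite -!big_distrr /= !mul2n => eq_fg.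
have eq0 : f 0%N = g 0%N by move/(congr1 odd): eq_fg; rewrite !oddD !odd_double !addbF !oddb.
move: eq_fg; rewrite eq0 => /addnI/double_inj eq_fg [|i] //= lt_in.
exact: (IHn (fun i => f i.+1) (fun i => g i.+1)).
Qed.

Lemma binary_sum_lt n (f : nat -> bool) : (\sum_(i < n) f i * 2 ^ i < 2 ^ n)%N.
Proof.
elim: n => [|n IHn]; first by rewrite big_ord0.
rewrite big_ord_recr /= expnS mul2n -addnn -addSn leq_add //.
by case: (f n); rewrite ?mul1n ?mul0n.
Qed.

(** The exponent of [a] in the product of the [a ^+ (2 ^ i)] for [i] in [T]. *)
Definition weight n (T : {set 'I_n}) := (\sum_(i in T) 2 ^ i)%N.

Let bit n (T : {set 'I_n}) (i : nat) := [exists j in T, j == i :> nat].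

Let bitE n (T : {set 'I_n}) (i : 'I_n) : bit T i = (i \in T).
Proof.
by apply/exists_inP/idP => [[j Tj /eqP/val_inj <-] // | Ti]; exists i.
Qed.

Let weightE n (T : {set 'I_n}) : weight T = (\sum_(i < n) bit T i * 2 ^ i)%N.
Proof.
rewrite /weight big_mkcond; apply: eq_bigr => i _.
by rewrite bitE; case: ifP; rewrite ?mul1n ?mul0n.
Qed.

Lemma weight_inj n : injective (@weight n).
Proof.
move=> T1 T2; rewrite !weightE => eqT; apply/setP => i.
by rewrite -!bitE (binary_sum_inj eqT).
Qed.

Lemma weight_lt n (T : {set 'I_n}) : (weight T < 2 ^ n)%N.
Proof. by rewrite weightE binary_sum_lt. Qed.

Lemma weight_setT n : weight [set: 'I_n] = (2 ^ n - 1)%N.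
Proof.
rewrite /weight; elim: n => [|n IHn]; first by rewrite big_pred0 // => -[].
rewrite (eq_bigl xpredT) in IHn; last by move=> i; rewrite inE.
rewrite (eq_bigl xpredT) => [|i]; last by rewrite inE.
by rewrite big_ord_recr /= IHn expnS mul2n -addnn addnC addnBA // expn_gt0.
Qed.

End BinaryWeight.

(** * Principal minors *)

Section PrincipalMinor.
Variables (R : comNzRingType) (n : nat).
Implicit Types (D : 'M[R]_n) (S T : {set 'I_n}).

(* The sum over permutations supported in [S] is the determinant of the submatrix
   on [S], without reindexing [S] by an ordinal type. *)
Definition pminor D S : R :=
  \sum_(s : 'S_n | perm_on S s) (-1) ^+ s * \prod_(i in S) D i (s i).

Lemma pminor0 D : pminor D set0 = 1.
Proof.
rewrite /pminor (big_pred1 1%g) => [|s].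
  by rewrite odd_perm1 expr0 mul1r big_set0.
apply/idP/eqP => [s0|->]; last exact: perm_on1.
by apply/permP => i; rewrite perm1 (out_perm s0) ?inE.
Qed.

Lemma pminorT D : pminor D setT = \det D.
Proof.
apply: eq_big => [s | s _]; first by apply/subsetP => i; rewrite inE.
by congr (_ * _); apply: eq_bigl => i; rewrite inE.
Qed.

(** When the product over rows is expanded, [T] records the rows where the diagonal term is chosen;
    such a product vanishes unless the permutation fixes [T] pointwise. *)
Lemma det_add_diag D (t : 'rV_n) :
  \det (D + diag_mx t) =
    \sum_(T : {set 'I_n}) pminor D (~: T) * \prod_(i in T) t 0 i.
Proof.
rewrite /determinant /pminor.
under [RHS]eq_bigr => T _ do rewrite big_distrl /= big_mkcond.
rewrite exchange_big /=; apply: eq_bigr => s _.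
under eq_bigr => i _ do rewrite !mxE addrC.
rewrite bigA_distr big_distrr /=; apply: eq_bigr => T _.
case: ifP => [sT | /negbT /subsetPn /= [i]].
  rewrite -mulrA; congr (_ * _); rewrite (bigID (mem T)) /= mulrC; congr (_ * _).
    by apply: eq_big => i; rewrite ?inE // => /negPf ->.
  apply: eq_bigr => i Ti; rewrite Ti (out_perm sT) ?eqxx // !inE Ti //.
rewrite !inE => /negPf si /negbNE Ti.
by rewrite (bigD1 i) //= Ti eq_sym si mulr0n mul0r mulr0.
Qed.

End PrincipalMinor.

(** * Chordless cycles in the digraph of nonzero entries *)

Section PrincipalMinorsOfACycle.
Variables (K : fieldType) (n : nat) (D : 'M[K]_n).

Let e : rel 'I_n := [rel i j | D i j != 0].

(** A permutation with a nonzero product moves each vertex of [c] along an edge, so without chords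
    [next c] is the only one that contributes. *)
Lemma pminor_ucycle (c : seq 'I_n) :
    ucycle e c -> (forall i j, i \in c -> j \in c -> e i j -> j = next c i) ->
  pminor D [set i in c] != 0.
Proof.
move=> /andP[cc Uc] chord.
pose s := perm (can_inj (prev_next Uc)).
have sE i : s i = next c i by rewrite permE.
have s_on : perm_on [set i in c] s.
  apply/subsetP => i; rewrite !inE sE; apply: contraR => ic.
  by rewrite next_nth (negPf ic).
rewrite /pminor (bigD1 s) //= [X in _ + X]big1 => [|t /andP[t_on nts]].
  rewrite addr0 mulf_neq0 ?signr_eq0 //; apply/prodf_neq0 => i; rewrite inE => ic.
  by rewrite sE; apply: (next_cycle cc).
have [/eqP/prodf_eq0[i ic /eqP z] | nz] := eqVneq (\prod_(i in [set i in c]) D i (t i)) 0.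
  by rewrite (bigD1 i ic) /= z mul0r mulr0.
case/eqP: nts; apply/permP => i; rewrite sE.
have [ic|ic] := boolP (i \in c).
  apply: chord => //; first by have := perm_closed i t_on; rewrite !inE ic.
  by move/prodf_neq0: nz; apply; rewrite inE.
by rewrite next_nth (negPf ic) (out_perm t_on) ?inE.
Qed.

(* A shortest cycle has no chord, so the principal minor on its vertices is a
   single nonzero product; hence it passes through every vertex. *)
Lemma hamiltonian_of_pminors :
    (forall S : {set 'I_n}, S != set0 -> S != setT -> pminor D S = 0) ->
    (0 < n)%N -> \det D != 0 ->
  exists c : seq 'I_n, [/\ uniq c, forall i, i \in c &
    forall i j, (D i j != 0) = (j == next c i)].
Proof.
move=> minor0 n_gt0 det_nz.
(* A nonzero term of the determinant is a permutation along edges, and its orbits are cycles of the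
   digraph. *)
have [s s_nz] : exists s : 'S_n, forall i, e i (s i).
  suff /existsP[s /forallP s_nz] : [exists s : 'S_n, [forall i, e i (s i)]] by exists s.
  apply: contraR det_nz => /existsPn no_s.
  rewrite /determinant big1 // => s _; have /forallPn[i /negbNE/eqP z] := no_s s.
  by rewrite (bigD1 i) //= z mul0r mulr0.
pose P k := [exists c : k.-tuple 'I_n, (0 < k)%N && ucycleb e c].
have exP : exists k, P k.
  pose c0 := fingraph.orbit s (Ordinal n_gt0).
  exists (size c0); apply/existsP; exists (in_tuple c0); rewrite /=.
  rewrite {1}/c0 size_orbit fingraph.order_gt0 //=.
  rewrite /ucycleb orbit_uniq andbT; apply: sub_cycle (cycle_orbit (@perm_inj _ s) _).
  by move=> i _ /eqP <-; apply: s_nz.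
have [k /existsP[[c /= /eqP sz_c] /andP[k_gt0 /andP[cc Uc]]] k_min] := ex_minnP exP.
(* An edge from [i] to [j] closes the stretch of [c] from [j] to [i] into a cycle; by minimality
   that stretch is all of [c]. *)
have chord i j : i \in c -> j \in c -> e i j -> j = next c i.
  move=> ic jc eij; have [r p cE] := rot_to jc.
  rewrite -(next_rot r Uc) cE; have := ic; rewrite -(mem_rot r) cE => ip.
  have Up : uniq (j :: p) by rewrite -cE rot_uniq.
  have cp : path.cycle e (j :: p) by rewrite -cE rot_cycle.
  have sz_p : size (j :: p) = k by rewrite -cE size_rot.
  case/splitPl: ip Up cp sz_p => p1 p2 lp1 Up cp sz_p.
  have : P (size (j :: p1)).
    apply/existsP; exists (in_tuple (j :: p1)); rewrite /= /ucycleb /=.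
    move: cp Up => /=; rewrite rcons_cat cat_path !rcons_path cat_uniq mem_cat negb_or => /andP[-> _].
    by rewrite lp1 eij => /andP[/andP[-> _] /andP[-> _]].
  move/k_min; rewrite -sz_p /= size_cat ltnS -{2}[size p1]addn0 leq_add2l leqn0.
  move=> /nilP p2E; subst p2; rewrite cats0 in Up *.
  by rewrite -[RHS]/(next (j :: p1) i) next_nth -lp1 mem_last index_last // nth_default.
have cT i : i \in c.
  suff cE : [set j in c] = setT by have := in_setT i; rewrite -cE inE.
  apply/eqP; apply: contraTT (pminor_ucycle _ chord) => [cN | //]; last first.
    by apply/andP.
  rewrite negbK minor0 //; apply/set0Pn; move: sz_c k_gt0.
  by case: c {cc Uc chord cN} => [<- //|j c _ _]; exists j; rewrite !inE eqxx.
exists c; split=> // i j; apply/idP/eqP => [eij | ->]; first exact: chord.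
exact: (next_cycle cc).
Qed.

End PrincipalMinorsOfACycle.

(** * Payne's theorem *)

Section Payne.
Variables (K : finFieldType) (n : nat).
Hypothesis cardK : #|K| = (2 ^ n.+1)%N.

Lemma pchar2 : 2 \in [pchar K].
Proof. exact: card_finPcharP cardK _. Qed.

Lemma expr_sum_2X k I (r : seq I) (P : pred I) (E : I -> K) :
  (\sum_(i <- r | P i) E i) ^+ (2 ^ k) = \sum_(i <- r | P i) E i ^+ (2 ^ k).
Proof.
apply: (big_morph (fun x : K => x ^+ (2 ^ k))) => [x y|].
  by rewrite exprDn_pchar // pnatX pnatE // pchar2.
by rewrite expr0n expn_eq0.
Qed.

(** This lets Frobenius exponents be indexed by ['I_n.+1] with its cyclic addition. *)
Lemma expf_2X_mod (x : K) k : x ^+ (2 ^ (k %% n.+1)) = x ^+ (2 ^ k).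
Proof.
rewrite [in RHS](divn_eq k n.+1) expnD exprM; congr (_ ^+ _).
elim: (k %/ n.+1)%N => [|j IHj]; first by rewrite mul0n expr1.
by rewrite mulSn expnD exprM -cardK expf_card.
Qed.

(* Row k, column l holds the coefficient of [x ^ (2 ^ k)] in the [2 ^ l]-th power of
   [\sum_i c 0 i * x ^ (2 ^ i)]. *)
Definition dickson_mx (c : 'rV[K]_n.+1) : 'M[K]_n.+1 :=
  \matrix_(k, l) c 0 (k - l) ^+ (2 ^ l).

Definition linpoly_eval (c : 'rV[K]_n.+1) (x : K) : K :=
  \sum_i c 0 i * x ^+ (2 ^ i).

Lemma dickson_mxP (c : 'rV[K]_n.+1) x :
  \row_k x ^+ (2 ^ k) *m dickson_mx c = \row_l linpoly_eval c x ^+ (2 ^ l).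
Proof.
apply/rowP => l; rewrite !mxE expr_sum_2X (reindex_inj (addIr l)) /=.
apply: eq_bigr => i _; rewrite !mxE addrK exprMn mulrC; congr (_ * _).
by rewrite -exprM -expnD expf_2X_mod.
Qed.

(** Not the usual characteristic polynomial: the [k]-th diagonal entry is shifted by
    ['X^(2 ^ k)]. *)
Definition dickson_charpoly (c : 'rV[K]_n.+1) : {poly K} :=
  \sum_T (pminor (dickson_mx c) (~: T))%:P * 'X^(weight T).

Lemma horner_dickson_charpoly c a :
  (dickson_charpoly c).[a] = \det (dickson_mx c + diag_mx (\row_k a ^+ (2 ^ k))).
Proof.
rewrite det_add_diag horner_sum; apply: eq_bigr => T _.
rewrite !hornerE expr_sum; congr (_ * _).
by apply: eq_bigr => i _; rewrite mxE.
Qed.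

Lemma coef_dickson_charpoly c T :
  (dickson_charpoly c)`_(weight T) = pminor (dickson_mx c) (~: T).
Proof.
rewrite coef_sum (bigD1 T) //= coefCM coefXn eqxx mulr1 big1 ?addr0 // => S /negPf neqST.
by rewrite coefCM coefXn (inj_eq (@weight_inj _)) eq_sym neqST mulr0.
Qed.

(** The difference of the two sides has degree below [2 ^ n.+1 - 1], yet vanishes at every nonzero
    [a]. *)
Lemma dickson_charpolyE c :
    (forall a, a != 0 -> exists2 x, x != 0 & linpoly_eval c x = a * x) ->
  dickson_charpoly c = 'X^(2 ^ n.+1 - 1) - 1.
Proof.
move=> solvable; apply/eqP; rewrite -subr_eq0; set q := (X in 'X^X).
have q_gt0 : (0 < q)%N by rewrite subn_gt0 -{1}(expn0 2) ltn_exp2l.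
pose P := dickson_charpoly c - ('X^q - 1); rewrite -[X in X == 0]/P.
have szP : (size P <= q)%N.
  (* The exponent [q] is the weight of the full set; its coefficient is the empty minor 1, which
     cancels against ['X^q]. *)
  apply/leq_sizeP => j; rewrite leq_eqVlt => /predU1P[<-|lt_qj].
    rewrite !coefB coefXn coef1 eqxx (gtn_eqF q_gt0) /q -(weight_setT n.+1).
    by rewrite coef_dickson_charpoly setCT pminor0 subr0 subrr.
  rewrite !coefB coefXn coef1 (gtn_eqF lt_qj) (gtn_eqF (ltn_trans q_gt0 lt_qj)).
  rewrite subr0 subr0 coef_sum big1 // => T _; rewrite coefCM coefXn.
  rewrite gtn_eqF ?mulr0 //; apply: leq_trans lt_qj.
  by rewrite /q subn1 prednK ?expn_gt0 // weight_lt.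
apply: contraTT szP => P_nz; rewrite -ltnNge.
have -> : q = size (enum [pred a : K | a != 0]).
  by rewrite -cardE cardC1 cardK /q subn1.
apply: max_poly_roots => //; last exact: enum_uniq.
apply/allP => a; rewrite mem_enum inE => a_nz.
have [x x_nz cx] := solvable a a_nz.
rewrite rootE !hornerE horner_dickson_charpoly.
(* The conjugates of [x] form a left null vector: both summands send it to the conjugates of
   [a * x], which cancel in characteristic 2. *)
have -> : \det (dickson_mx c + diag_mx (\row_k a ^+ (2 ^ k))) = 0.
  apply/eqP/det0P; exists (\row_k x ^+ (2 ^ k)).
    apply: contraNneq x_nz => /rowP/(_ 0); rewrite !mxE => /eqP.
    by rewrite expf_eq0 => /andP[].
  rewrite mulmxDr dickson_mxP; apply/rowP => l.
  rewrite mul_mx_diag !mxE cx exprMn [X in _ + X]mulrC.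
  by rewrite addrr_pchar2 // pchar2.
have aq : a ^+ q = 1.
  apply: (mulfI a_nz); rewrite -exprS mulr1 /q subn1 prednK ?expn_gt0 //.
  by rewrite -cardK expf_card.
by rewrite aq subrr subrr.
Qed.

Lemma payne_monomial c :
    (forall a, a != 0 -> exists2 x, x != 0 & linpoly_eval c x = a * x) ->
  exists i : 'I_n.+1,
    [/\ coprime i n.+1, c 0 i != 0 & forall j, j != i -> c 0 j = 0].
Proof.
move=> /dickson_charpolyE PE.
have minorE (S : {set 'I_n.+1}) :
    pminor (dickson_mx c) S = (S == set0)%:R - (S == setT)%:R.
  rewrite -(inj_eq (@setC_inj _) S set0) -(inj_eq (@setC_inj _) S setT) setC0 setCT.
  rewrite -{1}[S]setCK; set T := ~: S.
  rewrite -coef_dickson_charpoly PE coefB coefXn coef1 -(weight_setT n.+1).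
  have -> : (weight T == 0%N) = (T == set0).
    by rewrite -(inj_eq (@weight_inj _)) [weight set0]big_set0.
  by rewrite (inj_eq (@weight_inj _)).
have [|//||s [Us sT sE]] := @hamiltonian_of_pminors _ _ (dickson_mx c).
- by move=> S S0 ST; rewrite minorE (negPf S0) (negPf ST) subrr.
- rewrite -pminorT minorE eqxx -[setT == set0]negbK.
  by rewrite (_ : setT != set0) ?sub0r ?oppr_eq0 ?oner_eq0 //; apply/set0Pn; exists 0.
have nz i j : (c 0 (i - j) != 0) = (j == next s i).
  by rewrite -sE mxE expf_eq0 expn_gt0 /=.
have ck i : (c 0 i != 0) = (i == prev s 0).
  rewrite -[i in c 0 i]subr0 nz; apply/eqP/eqP => [-> | ->].
    by rewrite (prev_next Us).
  by rewrite (next_prev Us).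
set k := prev s 0 in ck; exists k; split; last 2 first.
- by rewrite ck.
- by move=> j; rewrite -ck negbK => /eqP.
(* The successor map is translation by [- k]. Its orbit of 0 is everything, so it reaches -1, and
   [k] is invertible modulo [n.+1]. *)
have sB i : next s i = i - k by apply/esym/eqP; rewrite -nz subKr ck.
have s_iter j : iter j (next s) 0 = - (k *+ j).
  by elim: j => [|j IHj]; rewrite ?oppr0 //= IHj sB mulrS opprD addrC.
have := iter_findex (y := - inZp 1) (etrans (fconnect_cycle (cycle_next Us) (sT 0) _) (sT _)).
rewrite s_iter Zp_mulrn => /oppr_inj/(congr1 val) /= kj.
have : coprime (k * findex (next s) 0 (- inZp 1)) n.+1.
  by rewrite -coprime_modl kj coprime_modl coprime1n.
by rewrite coprimeMl => /andP[].
Qed.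

End Payne.

(** * Rank and kernel of a word *)

Section RankWeight.
Import VectorInternalTheory.
Variables (F : finFieldType) (L : fieldExtType F) (n : nat).
Local Notation K := (finvect_type L).

(** A word is viewed as an [F]-linear map into [K] of the same rank, so that questions on ranks
    become counts of zeros. *)
Definition fcomb (v : 'rV[K]_n) (x : 'rV[F]_n) : K := \sum_j x 0 j *: v 0 j.

Definition fker (v : 'rV[K]_n) : {set 'rV[F]_n} := [set x | fcomb v x == 0].

Definition coord_mx (v : 'rV[K]_n) : 'M[F]_(n, dim L) :=
  \matrix_j v2r (v 0 j : L).

Lemma rkE (v : 'rV[K]_n) : rk v = \rank (coord_mx v).
Proof.
pose X := mktuple (fun i => v 0 i : L).
have spanE (Y : n.-tuple L) : span Y = mx2vs (b2mx Y).
  by rewrite unlock tvalK; case: _ / (esym _).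
have -> : rk v = \dim <<X>> by [].
rewrite spanE /dimv genmxE; congr (\rank _).
by apply/row_matrixP => j; rewrite !rowK tnth_mktuple.
Qed.

Lemma fcombE v x : fcomb v x = r2v (x *m coord_mx v).
Proof.
rewrite mulmx_sum_row linear_sum; apply: eq_bigr => j _.
by rewrite linearZ /= rowK v2rK.
Qed.

Lemma rk_le (v : 'rV[K]_n) : (rk v <= n)%N.
Proof. by rewrite rkE rank_leq_row. Qed.

Lemma card_fker (v : 'rV[K]_n) : #|fker v| = (#|F| ^ (n - rk v))%N.
Proof.
rewrite rkE -mxrank_ker -card_rowg; apply: eq_card => x.
rewrite mem_rowg inE fcombE sub_kermx -(inj_eq (can_inj (@r2vK F L))).
by rewrite linear0.
Qed.

(** The bound [d <= n] takes care of the default value [n] of the minimum. *)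
Lemma min_distance_geq d (C : rank_code L n) : (d <= n)%N ->
  (d <= min_distance C)%N = [forall v, (v \in C) && (v != 0) ==> (d <= rk v)%N].
Proof.
move=> le_dn; rewrite /min_distance (big_morph (leq d) (id1 := true) (op1 := andb)) //.
  by rewrite big_andE.
by move=> i j; rewrite leq_min.
Qed.

Lemma coord_mx_inj : injective coord_mx.
Proof.
move=> u v /row_matrixP uv; apply/rowP => j.
by have := uv j; rewrite !rowK => /(can_inj v2rK).
Qed.

End RankWeight.

(** In this dimension [coord_mx] is square, and full-rank words correspond to invertible
    matrices. *)
Lemma card_full_rank (F : finFieldType) (L : fieldExtType F) n :
  \dim {:L} = n.+1 ->
  #|[set v : 'rV[finvect_type L]_n.+1 | rk v == n.+1]| = #|('GL_n.+1[F])%g|.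
Proof.
rewrite dimvf => dimL.
have -> : #|('GL_n.+1[F])%g| = #|[set A : 'M[F]_(n.+1, dim L) | \rank A == n.+1]|.
  rewrite cardsT /= card_sub dimL; apply: eq_card => A.
  by rewrite [RHS]inE -[RHS]/(row_free A) row_free_unit.
rewrite -(card_imset _ (@coord_mx_inj F L n.+1)); apply: eq_card => A.
rewrite inE; apply/imsetP/idP => [[v] | rA]; first by rewrite inE rkE => rv ->.
pose v : 'rV[finvect_type L]_n.+1 := \row_j (VectorInternalTheory.r2v (row j A) : L).
have AE : A = coord_mx v by apply/row_matrixP => j; rewrite rowK mxE VectorInternalTheory.r2vK.
by exists v; rewrite // inE rkE -AE.
Qed.

(** * MRD codes of dimension 2 over F_2 *)

Section MooreMatrix.
Variables (F : finFieldType) (L : fieldExtType F) (n : nat).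
Hypotheses (cardF : #|F| = 2%N) (dimL : \dim {:L} = n.+1).
Local Notation K := (finvect_type L).
Local Notation m := n.+1.
Implicit Types (g v h : 'rV[K]_m) (x : 'rV[F]_m) (C : rank_code L m).

Lemma cardK : #|K| = (2 ^ m)%N.
Proof.
by rewrite -cardF -dimL -(@card_vspace F K _ fullv) card_vspacef.
Qed.

Definition frobv i g : 'rV[K]_m := \row_j g 0 j ^+ (2 ^ i).

Lemma fcomb_frobv i g x : fcomb (frobv i g) x = fcomb g x ^+ (2 ^ i).
Proof.
rewrite /fcomb (expr_sum_2X cardK); apply: eq_bigr => j _.
rewrite exprZn mxE; congr (_ *: _); elim: i => [|i IHi]; first by rewrite expr1.
by rewrite expnSr exprM -IHi -cardF expf_card.
Qed.

Lemma fcombB v h x : fcomb (v - h) x = fcomb v x - fcomb h x.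
Proof. by rewrite /fcomb -sumrB; apply: eq_bigr => j _; rewrite !mxE scalerBr. Qed.

Lemma fcombD v h x : fcomb (v + h) x = fcomb v x + fcomb h x.
Proof. by rewrite /fcomb -big_split; apply: eq_bigr => j _; rewrite !mxE scalerDr. Qed.

Lemma fcombZ (a : K) v x : fcomb (a *: v) x = a * fcomb v x.
Proof. by rewrite /fcomb big_distrr; apply: eq_bigr => j _; rewrite !mxE /= -scalerAr. Qed.

Lemma fcomb0 v : fcomb v 0 = 0.
Proof. by rewrite /fcomb big1 // => j _; rewrite mxE scale0r. Qed.

Lemma fcombBr v x y : fcomb v (x - y) = fcomb v x - fcomb v y.
Proof. by rewrite /fcomb -sumrB; apply: eq_bigr => j _; rewrite !mxE scalerBl. Qed.

(** The kernel has [2 ^ (m - rk v)] elements, so the rank is at least [n] exactly when there are at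
    most two of them, one being 0. *)
Lemma rk_large v : (n <= rk v)%N =
  [forall x, forall y, (x != 0) && (y != 0) && (fcomb v x == 0) && (fcomb v y == 0) ==> (x == y)].
Proof.
have fker0 : 0 \in fker v by rewrite inE fcomb0.
have -> : (n <= rk v)%N = (#|fker v| <= 2)%N.
  rewrite card_fker cardF; transitivity (2 ^ (m - rk v) <= 2 ^ 1)%N => //; rewrite leq_exp2l //.
  by rewrite leq_subLR addn1 ltnS.
rewrite (cardsD1 0) fker0 ltnS; apply/card_le1_eqP/forallP => [sub x | sub x y].
  apply/forallP => y; apply/implyP => /andP[/andP[/andP[x0 y0] vx] vy].
  by apply/eqP; apply: sub; rewrite !inE ?x0 ?y0.
rewrite !inE => /andP[x0 vx] /andP[y0 vy].
by have /forallP/(_ y) := sub x; rewrite x0 y0 vx vy => /eqP.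
Qed.

Section FullRank.
Variable g : 'rV[K]_m.
Hypothesis rg : rk g = m.

Lemma fcomb_inj : injective (fcomb g).
Proof.
move=> x y /eqP; rewrite -subr_eq0 -fcombBr => gxy; apply/eqP; rewrite -subr_eq0.
have : x - y \in fker g by rewrite inE.
have : fker g = [set 0].
  have := card_fker g; rewrite rg subnn => /eqP/cards1P[z fkg].
  have : 0 \in fker g by rewrite inE fcomb0.
  by rewrite fkg inE => /eqP ->.
by move->; rewrite inE.
Qed.

Lemma fcomb_surj z : exists x, fcomb g x = z.
Proof.
have : z \in codom (fcomb g).
  apply: (inj_card_onto fcomb_inj); rewrite card_mx mul1n cardF.
  by rewrite cardK.
by case/codomP => x ->; exists x.
Qed.

Definition moore_mx : 'M[K]_m := \matrix_i frobv i g.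

Lemma fcomb_moore (c : 'rV[K]_m) x :
  fcomb (c *m moore_mx) x = linpoly_eval c (fcomb g x).
Proof.
rewrite mulmx_sum_row /linpoly_eval.
transitivity (\sum_i fcomb (c 0 i *: frobv i g) x).
  rewrite /fcomb exchange_big; apply: eq_bigr => j _.
  rewrite summxE scaler_sumr; apply: eq_bigr => i _.
  by rewrite rowK.
by apply: eq_bigr => i _; rewrite fcombZ fcomb_frobv.
Qed.

(** As [fcomb g] is onto, a left null vector yields a linearized polynomial of degree below [2 ^ m]
    vanishing on all of [K]. *)
Lemma moore_unit : moore_mx \in unitmx.
Proof.
rewrite -row_free_unit -kermx_eq0; apply/rowV0P => c /sub_kermxP cM.
have c0 z : linpoly_eval c z = 0.
  have [x <-] := fcomb_surj z; rewrite -fcomb_moore cM.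
  by rewrite /fcomb big1 // => j _; rewrite mxE scaler0.
pose P : {poly K} := \sum_i (c 0 i)%:P * 'X^(2 ^ i).
have PE z : P.[z] = 0.
  by rewrite -(c0 z) horner_sum; apply: eq_bigr => i _; rewrite !hornerE.
have P0 : P = 0.
  apply/eqP; apply: contraT => P_nz.
  have := max_poly_roots P_nz _ (enum_uniq K); rewrite -cardE cardK => lt_P.
  have /lt_P : all (root P) (enum K) by apply/allP => z _; rewrite rootE PE.
  suff szP : (size P <= 2 ^ m)%N by rewrite ltnNge szP.
  apply: (leq_trans (size_sum _ _ _)); apply/bigmax_leqP => i _.
  rewrite mul_polyC; apply: (leq_trans (size_scale_leq _ _)).
  by rewrite size_polyXn ltn_exp2l.
apply/rowP => i; rewrite mxE; have := congr1 (fun p : {poly K} => p`_(2 ^ i)) P0.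
rewrite coef0 coef_sum (bigD1 i) //= coefCM coefXn eqxx mulr1 big1 ?addr0 // => j nij.
by rewrite coefCM coefXn (inj_eq (@expnI 2 _)) // eq_sym (inj_eq val_inj) (negPf nij) mulr0.
Qed.

End FullRank.
End MooreMatrix.

(** * Gabidulin codes and the MRD codes through a full-rank word *)

Section GabidulinCodes.
Variables (F : finFieldType) (L : fieldExtType F) (n : nat).
Hypotheses (cardF : #|F| = 2%N) (dimL : \dim {:L} = n.+1) (n_gt0 : (0 < n)%N).
Local Notation K := (finvect_type L).
Local Notation m := n.+1.
Implicit Types (g v h : 'rV[K]_m) (x : 'rV[F]_m) (C : rank_code L m).
Let cardK : #|K| = (2 ^ m)%N := cardK cardF dimL.

Definition mrd C := (\dim C == 2%N) && (n <= min_distance C)%N.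

Lemma mrd_rk C v : mrd C -> v \in C -> v != 0 -> (n <= rk v)%N.
Proof.
rewrite /mrd min_distance_geq // => /andP[_ /forallP/(_ v) min_v] vC v0.
by move: min_v; rewrite vC v0.
Qed.

(** With [i * u] congruent to 1 modulo [m], iterating the equation [u] times gives [z ^+ 2 = z]. *)
Lemma expf_2X_coprime (z : K) i : coprime i m -> z != 0 -> z ^+ (2 ^ i) = z -> z = 1.
Proof.
move=> co_im z0 zi.
have [u ui] : exists u, (i * u = 1 %[mod m])%N.
  exists (chinese i m 0 1 %/ i)%N; rewrite mulnC divnK ?chinese_modr //.
  by rewrite /dvdn chinese_modl // mod0n.
have : z ^+ (2 ^ (i * u)) = z.
  elim: u {ui} => [|u IHu]; first by rewrite muln0 expr1.
  by rewrite mulnS expnD exprM zi.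
rewrite -(expf_2X_mod cardK) ui (expf_2X_mod cardK) expn1 expr2 => zz.
by apply: (mulfI z0); rewrite zz mulr1.
Qed.

Definition gabidulin g i : rank_code L m := <<[:: g; frobv i g]>>%VS.

Lemma mem_gabidulin g i v :
  reflect (exists a b : K, v = a *: g + b *: frobv i g) (v \in gabidulin g i).
Proof.
rewrite /gabidulin span_cons span_seq1; apply: (iffP memv_addP).
  by case=> _ /vlineP[a ->] [_ /vlineP[b ->] ->]; exists a, b.
by case=> a [b ->]; exists (a *: g); rewrite ?memvZ ?memv_line //;
   exists (b *: frobv i g); rewrite ?memvZ ?memv_line.
Qed.

Section FullRank.
Variable g : 'rV[K]_m.
Hypothesis rg : rk g = m.

Let M := moore_mx g.
Let Mu : M \in unitmx := moore_unit cardF dimL rg.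

Lemma row_moore (i : 'I_m) : delta_mx 0 i *m M = frobv i g.
Proof. by rewrite -rowE rowK. Qed.

Lemma frobv0 : frobv 0 g = g.
Proof. by apply/rowP => j; rewrite mxE expr1. Qed.

(** Since [M] is invertible, identities between such words can be read off coordinatewise. *)
Lemma comb_moore (a b : K) (i : 'I_m) :
  a *: g + b *: frobv i g = (a *: delta_mx 0 0 + b *: delta_mx 0 i) *m M.
Proof. by rewrite mulmxDl -!scalemxAl !row_moore frobv0. Qed.

Lemma dim_gabidulin (i : 'I_m) : i != 0 -> \dim (gabidulin g i) = 2%N.
Proof.
move=> i0; apply/eqP; rewrite -[_ == _]/(free [:: g; frobv i g]).
rewrite free_cons seq1_free span_seq1; apply/andP; split.
  apply: contraNN i0 => /vlineP[k gE].
  have : 1 *: g + (- k) *: frobv i g = 0 by rewrite scale1r {1}gE scaleNr subrr.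
  rewrite comb_moore -(mul0mx _ M) => /(can_inj (mulmxK Mu))/rowP/(_ 0).
  rewrite !mxE !eqxx mulr1 [0 == i]eq_sym; case: (i == 0) => // /eqP.
  by rewrite mulr0 addr0 oner_eq0.
rewrite -row_moore; apply/negP => /eqP; rewrite -(mul0mx _ M).
move=> /(can_inj (mulmxK Mu))/rowP/(_ i); rewrite !mxE !eqxx => /eqP.
by rewrite oner_eq0.
Qed.

Lemma coprime_neq0 (i : 'I_m) : coprime i m -> i != 0.
Proof.
by apply: contraL => /eqP ->; rewrite /coprime gcd0n eqSS -lt0n.
Qed.

Lemma gabidulin_inj (i j : 'I_m) : i != 0 -> gabidulin g i = gabidulin g j -> i = j.
Proof.
move=> i0 eq_ij; have /mem_gabidulin[a [b]] : frobv i g \in gabidulin g j.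
  by rewrite -eq_ij; apply/mem_gabidulin; exists 0, 1; rewrite scale0r scale1r add0r.
rewrite comb_moore -row_moore => /(can_inj (mulmxK Mu))/rowP/(_ i).
rewrite !mxE !eqxx (negPf i0) mulr0 add0r; case: eqP => // _ /eqP.
by rewrite mulr0 oner_eq0.
Qed.

(** If nonzero [x] and [y] annihilate the same nonzero codeword, their images [p] and [q] both solve
    [z ^+ (2 ^ i) = - (a / b) * z]; then [p / q] is fixed by the [i]-th Frobenius power and equals
    1. *)
Lemma gabidulin_mrd (i : 'I_m) : coprime i m -> mrd (gabidulin g i).
Proof.
move=> co_i; rewrite /mrd dim_gabidulin ?coprime_neq0 // min_distance_geq //=.
apply/forallP => v; apply/implyP => /andP[/mem_gabidulin[a [b vE]] v0].
rewrite (rk_large cardF); apply/forallP => x; apply/forallP => y; apply/implyP.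
rewrite vE !fcombD !fcombZ !(fcomb_frobv cardF dimL) => /andP[/andP[/andP[x0 y0] vx] vy].
apply/eqP/(fcomb_inj rg); set p := fcomb g x in vx *; set q := fcomb g y in vy *.
have fc0 z : z != 0 -> fcomb g z != 0.
  by apply: contraNneq => gz; apply/eqP/(fcomb_inj rg); rewrite gz fcomb0.
have [p0 q0] : p != 0 /\ q != 0 by rewrite /p /q !fc0.
have b0 : b != 0.
  apply: contraNneq v0 => b0; rewrite vE b0 scale0r addr0.
  by move: vx; rewrite b0 mul0r addr0 mulf_eq0 (negPf p0) orbF => /eqP ->; rewrite scale0r.
have pE z : a * z + b * z ^+ (2 ^ i) == 0 -> z ^+ (2 ^ i) = - (a / b) * z.
  rewrite addrC addr_eq0 => /eqP bz; apply: (mulfI b0).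
  by rewrite bz mulrA mulrN mulrCA divff // mulr1 mulNr.
suff : p / q = 1 by move/(canRL (divfK q0)); rewrite mul1r.
apply: (expf_2X_coprime co_i); first by rewrite mulf_neq0 ?invr_eq0.
have a0 : - (a / b) != 0.
  by apply: contraNneq p0 => ab; have := pE _ vx; rewrite ab mul0r => /eqP; rewrite expf_eq0 => /andP[].
by rewrite expr_div_n (pE _ vx) (pE _ vy) -mulf_div divff // mul1r.
Qed.

Lemma full_rank_neq0 : g != 0.
Proof.
apply: contraNneq (oner_neq0 K) => g0.
have [x <-] := fcomb_surj cardF dimL rg 1.
by rewrite g0 /fcomb big1 // => j _; rewrite mxE scaler0.
Qed.

Lemma mrd_gabidulin C : mrd C -> g \in C ->
  exists2 i : 'I_m, coprime i m & C = gabidulin g i.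
Proof.
move=> mrdC gC; have dimC : \dim C = 2%N by case/andP: mrdC => /eqP.
have g0 := full_rank_neq0.
have /subvPn[h hC hg] : ~~ (C <= <[g]>)%VS.
  by apply/negP => /dimvS; rewrite dimC dim_vline g0.
have [c hE] : exists c : 'rV[K]_m, h = c *m M by exists (h *m invmx M); rewrite mulmxKV.
(* [h - a g] is a nonzero codeword, so its rank is at least [m - 1] and it is
   annihilated by at most one nonzero point. *)
have inj (p q : K) : p != 0 -> q != 0 -> linpoly_eval c p / p = linpoly_eval c q / q -> p = q.
  move=> p0 q0 pq; set a := linpoly_eval c p / p in pq.
  have ap : linpoly_eval c p = a * p by rewrite /a divfK.
  have aq : linpoly_eval c q = a * q by rewrite pq divfK.
  have [x xp] := fcomb_surj cardF dimL rg p; have [y yq] := fcomb_surj cardF dimL rg q.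
  have v0 : h - a *: g != 0.
    by apply: contraNneq hg => /subr0_eq ->; rewrite memvZ ?memv_line.
  have := mrd_rk mrdC (memvB hC (memvZ a gC)) v0.
  rewrite (rk_large cardF) => /forallP/(_ x)/forallP/(_ y).
  rewrite !fcombB !fcombZ hE !(fcomb_moore cardF dimL) xp yq.
  rewrite ap aq !subrr eqxx !andbT => /implyP xy.
  rewrite -xp -yq; congr fcomb; apply/eqP/xy/andP; split.
    by apply: contraNneq p0 => x0; rewrite -xp x0 fcomb0.
  by apply: contraNneq q0 => y0; rewrite -yq y0 fcomb0.
(* By injectivity there are [#|K| - 1] slopes, hence exactly one omitted value [a0]. *)
pose nz := [set z : K | z != 0]; pose slope (z : K) := linpoly_eval c z / z.
have card_nz : #|nz| = #|K|.-1 by rewrite -(cardC1 0); apply: eq_card => z; rewrite !inE.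
have slope_inj : {in nz &, injective slope} by move=> p q; rewrite !inE; apply: inj.
have card_slope : #|slope @: nz| = #|K|.-1 by rewrite card_in_imset.
have [a0 a0_slope] : exists a0, a0 \notin slope @: nz.
  apply/existsP; rewrite -negb_forall; apply/negP => /forallP all_slope.
  have : #|slope @: nz| = #|K| by apply: eq_card => z; rewrite all_slope.
  by rewrite card_slope cardK; case: (2 ^ m)%N (expn_gt0 2 m) => // k _ /n_Sn.
(* Passing from [h] to [h - a0 *: g] shifts the slopes so that they fill the nonzero elements. *)
pose c' := c - a0 *: delta_mx 0 0.
have c'E z : linpoly_eval c' z = linpoly_eval c z - a0 * z.
  rewrite /linpoly_eval [in RHS](bigD1 0) // [in LHS](bigD1 0) //= !mxE !eqxx mulr1.
  rewrite mulrBl expr1 addrAC; congr (_ + _ - _).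
  by apply: eq_bigr => i /negPf i0; rewrite !mxE eqxx i0 mulr0 subr0.
have slopeC : slope @: nz = [set~ a0].
  apply/eqP; rewrite eqEcard card_slope cardsC1 leqnn andbT.
  by apply/subsetP => z zs; rewrite !inE; apply: contraNneq a0_slope => <-.
have [a a_nz | i [co_i ci_nz c'0]] := @payne_monomial K n cardK c'.
  have : a + a0 \in slope @: nz.
    by rewrite slopeC !inE -subr_eq0 addrK.
  case/imsetP => z; rewrite inE => z0 az; exists z => //.
  by rewrite c'E -[linpoly_eval c z](divfK z0) -/(slope z) -az mulrDl addrK.
exists i => //; apply/eqP; rewrite eq_sym eqEdim dimC dim_gabidulin ?coprime_neq0 //.
rewrite leqnn andbT; apply/subvP => v /mem_gabidulin[a [b ->]].
(* Only one coordinate of [c'] is nonzero, so [h - a0 *: g] is a multiple of [frobv i g]. *)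
have -> : frobv i g = (c' 0 i)^-1 *: (h - a0 *: g).
  have c'_delta : c' = c' 0 i *: delta_mx 0 i.
    apply/rowP => j; rewrite [RHS]mxE [delta_mx _ _ _ _]mxE eqxx /=.
    by have [->|/c'0 ->] := eqVneq j i; rewrite ?mulr1 ?mulr0.
  apply: (canRL (scalerK ci_nz)); rewrite -row_moore scalemxAl -c'_delta.
  by rewrite /c' mulmxBl -hE -scalemxAl (row_moore 0) frobv0.
by rewrite memvD // memvZ // memvZ // memvB // memvZ.
Qed.

End FullRank.

End GabidulinCodes.

(** * Double counting of MRD codes and their full-rank words *)

Section CountingMRD.
Variables (F : finFieldType) (L : fieldExtType F) (n : nat).
Hypotheses (cardF : #|F| = 2%N) (dimL : \dim {:L} = n.+1) (n_gt0 : (0 < n)%N).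
Local Notation K := (finvect_type L).
Local Notation m := n.+1.
Implicit Types (g v h : 'rV[K]_m) (x : 'rV[F]_m) (C : rank_code L m).
Let cardK : #|K| = (2 ^ m)%N := cardK cardF dimL.

Lemma card_mrd_containing g : rk g = m ->
  #|[set C : rank_code L m | mrd C & g \in C]| = totient m.
Proof.
move=> rg; pose I := [set i : 'I_m | coprime i m].
have -> : totient m = #|I|.
  rewrite totient_count_coprime big_mkord cardsE -sum1_card big_mkcond /=.
  rewrite [RHS]big_mkcond; apply: eq_bigr => i _.
  by rewrite coprime_sym unfold_in -[eqn _ _]/(coprime i m); case: coprime.
have injG : {in I &, injective (fun i : 'I_m => gabidulin g i)}.
  move=> i j; rewrite inE => co_i _; apply: gabidulin_inj => //; exact: coprime_neq0.
rewrite -(card_in_imset injG).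
apply: eq_card => C; rewrite inE; apply/andP/imsetP => [[mrdC gC] | [i]].
    have [i co_i CE] := mrd_gabidulin cardF dimL n_gt0 rg mrdC gC.
    by exists i; rewrite ?inE.
  rewrite inE => co_i ->; split; first exact: gabidulin_mrd.
  by apply/mem_gabidulin; exists 1, 0; rewrite scale1r scale0r addr0.
Qed.

Section Words.
Variable C : rank_code L m.
Hypothesis mrdC : mrd C.

Let dimC : \dim C = 2%N. Proof. by case/andP: mrdC => /eqP. Qed.

Lemma card_words : #|[set v | v \in C & v != 0]| = (#|K| ^ 2 - 1)%N.
Proof.
rewrite -dimC -card_vspace [in RHS](cardD1 0) mem0v addKn; apply: eq_card => v.
by rewrite !inE andbC.
Qed.

Let annihilator x : {vspace 'rV[K]_m} :=
  (C :&: lker (linfun (fun v : 'rV[K]_m => fcomb v x : K^o)))%VS.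

Let evalL x : linear (fun v : 'rV[K]_m => fcomb v x : K^o).
Proof. by move=> a u v; rewrite fcombD fcombZ. Qed.

Let mem_annihilator x v : (v \in annihilator x) = (v \in C) && (fcomb v x == 0).
Proof.
pose e := GRing.isLinear.Build _ _ _ _ _ (evalL x).
pose eL : {linear 'rV[K]_m -> K^o} := HB.pack (fun v : 'rV[K]_m => fcomb v x : K^o) e.
by rewrite memv_cap memv_ker (lfunE eL).
Qed.

Let dim_annihilator_gt0 x : (0 < \dim (annihilator x))%N.
Proof.
have := limg_ker_dim (linfun (fun v : 'rV[K]_m => fcomb v x : K^o)) C.
rewrite -/(annihilator x) dimC => dim2; rewrite lt0n; apply: contra_eqN dim2 => /eqP ->.
by rewrite add0n neq_ltn ltnS (leq_trans (dimvS (subvf _))) ?dimvf.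
Qed.

(** The annihilator of [x] is a line: were it all of [C], a nonzero word annihilated by another
    nonzero [y] would be killed by both points, and its rank would be too small. *)
Lemma card_annihilated x : x != 0 ->
  #|[set v | (v \in C) && (v != 0) & fcomb v x == 0]| = #|K|.-1.
Proof.
move=> x0.
have -> : [set v | (v \in C) && (v != 0) & fcomb v x == 0] = [set v in annihilator x] :\ 0.
  by apply/setP => v; rewrite !inE mem_annihilator -andbA andbCA.
have : (\dim (annihilator x) <= 1)%N.
  rewrite leqNgt; apply/negP => dim2.
  have annC : annihilator x = C.
    by apply/eqP; rewrite eqEdim capvSl dimC.
  (* As [m] is at least 2, the space has more than the two vectors 0 and [x]. *)
  have [y /andP[y0 yx]] : exists y : 'rV[F]_m, (y != 0) && (y != x).
    apply/existsP; rewrite -[X in is_true X]negbK negb_exists; apply/negP => /forallP all_y.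
    have : (#|[set: 'rV[F]_m]| <= #|[set 0%R; x]|)%N.
      apply/subset_leq_card/subsetP => y _; have := all_y y.
      by rewrite !inE negb_and !negbK.
    rewrite cardsT card_mx cardF mul1n cards2 => /leq_trans/(_ (leq_add (leqnn 1) (leq_b1 _))).
    by rewrite -[X in (_ <= X)%N](expn1 2) leq_exp2l // ltnS leqNgt n_gt0.
  have v0 := dim_annihilator_gt0 y; rewrite lt0n dimv_eq0 -vpick0 in v0.
  set v := vpick _ in v0; have := memv_pick (annihilator y); rewrite mem_annihilator.
  case/andP=> vC vy; have vx : fcomb v x == 0.
    by move: vC; rewrite -{1}annC mem_annihilator => /andP[].
  have := mrd_rk mrdC vC v0; rewrite (rk_large cardF) => /forallP/(_ y)/forallP/(_ x).
  by rewrite y0 x0 vx vy (negPf yx).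
have := dim_annihilator_gt0 x; case dimA : (\dim (annihilator x)) => [|[|//]] // _ _.
have := cardsD1 0 [set v in annihilator x]; rewrite inE mem0v add1n => cardA.
have : #|[set v in annihilator x]| = #|K| by rewrite cardsE card_vspace dimA.
by rewrite cardA => <-.
Qed.

(** Counting nonzero words with the nonzero points that annihilate them, a word of rank [n] occurs
    once and a word of rank [m] never; the former number [(#|K| - 1) ^ 2], out of [#|K| ^ 2 - 1]. *)
Lemma card_full_rank_words :
  #|[set v | v \in C & rk v == m]| = (2 * (#|K| - 1))%N.
Proof.
pose W := [set v | v \in C & v != 0].
have zeros v : v \in W ->
    (\sum_(x : 'rV[F]_m | x != 0%R) (fcomb v x == 0%R) = (rk v != m))%N.
  rewrite inE => /andP[vC v0]; rewrite -big_mkcondr /= sum1_card.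
  have := card_fker v; rewrite (cardsD1 0) {1}inE fcomb0 eqxx cardF.
  have -> : #|fker v :\ 0| = #|[pred x | (x != 0) && (fcomb v x == 0)]|.
    by apply: eq_card => x; rewrite !inE.
  have := mrd_rk mrdC vC v0; rewrite leq_eqVlt => /predU1P[<- | lt_n].
    by rewrite subSnn => /(canRL (addKn _)) ->; rewrite ltn_eqF.
  have -> : rk v = m by apply/eqP; rewrite eqn_leq rk_le.
  by rewrite subnn eqxx => /(canRL (addKn _)) ->.
have : (\sum_(v in W) (rk v != m) = #|K|.-1 * #|K|.-1)%N.
  rewrite -(eq_bigr _ zeros) exchange_big /=.
  rewrite (eq_bigr (fun=> #|K|.-1)) => [|x x0]; last first.
    rewrite -(card_annihilated x0) -sum1_card -big_mkcondr /=.
    by apply: eq_bigl => v; rewrite !inE.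
  rewrite sum_nat_const cardC1 card_mx mul1n cardF.
  by rewrite cardK.
rewrite -big_mkcondr /= sum1_card => card_short.
have := card_words; rewrite -/W -(cardsID [set v | rk v == m] W).
have -> : W :&: [set v | rk v == m] = [set v | v \in C & rk v == m].
  apply/setP => v; rewrite !inE andbAC andb_idr // => /andP[_ rv].
  exact: (full_rank_neq0 cardF dimL (eqP rv)).
have -> : #|W :\: [set v | rk v == m]| = (#|K|.-1 * #|K|.-1)%N.
  by rewrite -card_short; apply: eq_card => v; rewrite !inE [RHS]unfold_in inE andbC.
have : (0 < #|K|)%N by rewrite cardK expn_gt0.
by case: #|K| => // k _; rewrite -mulnn; move: #|_| => A; nia.
Qed.

End Words.

Lemma card_mrd_mul :
  (#|[set C : rank_code L m | mrd C]| * (2 * (#|K| - 1)) =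
     #|('GL_m[F])%g| * totient m)%N.
Proof.
rewrite -(card_full_rank dimL) -!sum_nat_const.
transitivity (\sum_(C in [set C : rank_code L m | mrd C])
   \sum_(g in [set g | rk g == m]) (g \in C))%N.
  apply: eq_bigr => C; rewrite inE => mrdC; rewrite -(card_full_rank_words mrdC).
  rewrite -sum1_card -big_mkcondr /=; apply: eq_bigl => g.
  by rewrite !inE andbC.
rewrite exchange_big /=; apply: eq_bigr => g; rewrite inE => /eqP rg.
rewrite -(card_mrd_containing rg) -sum1_card -big_mkcondr /=; apply: eq_bigl => C.
by rewrite !inE.
Qed.

End CountingMRD.

(** * Density *)

Section GaussianBinomial2.
Variables (K : finFieldType) (n : nat).
Local Notation V := 'rV[K]_n.
Implicit Types (u v : V) (W C : {vspace V}).

(** In this order [free_cons] says that [p.2] lies off the line of the nonzero [p.1], which gives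
    the fibers over the first component. *)
Definition free_pairs W : {set V * V} :=
  [set p | (p.1 \in W) && (p.2 \in W) & free [:: p.2; p.1]].

Lemma card_free_pairs W :
  #|free_pairs W| = ((#|K| ^ \dim W - 1) * (#|K| ^ \dim W - #|K|))%N.
Proof.
pose Wnz := [set u | u \in W & u != 0].
have cardW : #|[set v in W]| = (#|K| ^ \dim W)%N by rewrite cardsE card_vspace.
have <- : #|Wnz| = (#|K| ^ \dim W - 1)%N.
  rewrite -cardW (cardsD1 0 [set v in W]) inE mem0v addKn; apply: eq_card => v.
  by rewrite !inE andbC.
have fiber u : u \in Wnz -> #|[set v in W] :\: [set v in <[u]>%VS]| = (#|K| ^ \dim W - #|K|)%N.
  rewrite inE => /andP[uW u0]; rewrite cardsD cardW; congr subn.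
  rewrite (setIidPr _); first by rewrite cardsE card_vspace dim_vline u0 expn1.
  by apply/subsetP => v; rewrite !inE => /vlineP[k ->]; rewrite memvZ.
rewrite -sum_nat_const -(eq_bigr _ fiber) -sum1_card.
under [RHS]eq_bigr => u _ do rewrite -sum1_card.
rewrite pair_big_dep; apply: eq_bigl => -[u v] /=.
by rewrite !inE free_cons seq1_free span_seq1 /= -!andbA; do ![case: (_ \in _)|case: (_ != 0)].
Qed.

(** Ordered independent pairs are sorted by the unique plane that they span. *)
Lemma gaussian_binomial2 :
  (gaussian_binomial K n 2 * ((#|K| ^ 2 - 1) * (#|K| ^ 2 - #|K|)) =
     (#|K| ^ n - 1) * (#|K| ^ n - #|K|))%N.
Proof.
have dimV : \dim (fullv : {vspace V}) = n by rewrite dimvf /dim /= mul1n.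
rewrite -dimV -card_free_pairs dimV -sum_nat_const.
rewrite (eq_bigr (fun C => #|free_pairs C|)) => [|C]; last first.
  by rewrite inE card_free_pairs => /eqP ->.
under eq_bigr => C _ do rewrite -sum1_card big_mkcond /=.
rewrite exchange_big /= -sum1_card [RHS]big_mkcond /=; apply: eq_bigr => -[u v] _.
rewrite !inE !memvf /=; have [fuv|fuv] := boolP (free [:: v; u]); last first.
  by rewrite big1 // => C _; rewrite !inE (negPf fuv) andbF.
rewrite -big_mkcondr (big_pred1 <<[:: v; u]>>%VS) // => C; rewrite !inE /= fuv andbT.
apply/andP/eqP => [[/eqP dimC /andP[uC vC]] | ->].
  apply/esym/eqP; rewrite eqEdim dimC (eqP fuv) leqnn andbT.
  by apply/span_subvP => w; rewrite !inE => /orP[] /eqP ->.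
by rewrite (eqP fuv) eqxx !memv_span // !inE eqxx ?orbT.
Qed.

End GaussianBinomial2.

Lemma card_GL2_prod (R : realFieldType) (F : finFieldType) (m : nat) :
  #|F| = 2%N -> (0 < m)%N ->
  (#|('GL_m[F])%g|%:R : R) =
    2 ^+ (m ^ 2) * \prod_(1 <= j < m.+1) (1 - 1 / 2 ^+ j).
Proof.
move=> cardF m_gt0; rewrite card_GL // cardF natrM natrX natr_prod.
(* The order of the group is [2 ^ 'C(m, 2)] times the product of the [2 ^ j - 1]; each factor gives
   up a [2 ^ j]. *)
have -> : (m ^ 2 = 'C(m, 2) + \sum_(1 <= j < m.+1) j)%N.
  elim: m {m_gt0} => [|k IHk]; first by rewrite big_geq.
  rewrite big_nat_recr //= binS bin1 addnACA -IHk -mulnn; nia.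
rewrite exprD -mulrA; congr (_ * _).
rewrite expr_sum -big_split /=; apply: eq_big_nat => j /andP[j_gt0 _].
rewrite natrB ?expn_gt0 // natrX mulrBr mulr1 mul1r divff //.
Qed.

(** [N] stands for the number of MRD codes, [B] for that of all planes, [G] for the order of the
    linear group, [p] for the totient, [q] for [2 ^ m] and [b] for [2 ^ (m ^ 2 - m)]. *)
Lemma density_arith (R : realFieldType) (N B G p q b : R) :
  N * (2 * (q - 1)) = G * p ->
  B * ((q ^+ 2 - 1) * (q ^+ 2 - q)) = (q * b - 1) * (q * b - q) ->
  1 < q /\ 1 < b ->
  N / B = 1 / 2 * (p * G * (q ^+ 2 - 1) / ((q * b - 1) * (b - 1))).
Proof.
move=> E1 E2 [q_gt1 b_gt1].
have nz (x : R) : 0 < x -> x != 0 by move=> ?; rewrite gt_eqF.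
have q10 : q - 1 != 0 by apply: nz; lra.
have q20 : q ^+ 2 - 1 != 0 by apply: nz; nra.
have qq0 : q ^+ 2 - q != 0 by apply: nz; nra.
have qbq0 : q * b - q != 0 by apply: nz; nra.
have b10 : b - 1 != 0 by apply: nz; lra.
have qb10 : q * b - 1 != 0 by apply: nz; nra.
have -> : N = G * p / (2 * (q - 1)).
  by rewrite -E1; field; rewrite q10.
have -> : B = (q * b - 1) * (q * b - q) / ((q ^+ 2 - 1) * (q ^+ 2 - q)).
  by rewrite -E2; field; rewrite qq0 q20.
by field; rewrite b10 qb10 qq0 q20 qbq0 q10.
Qed.

Lemma density_mrd (R : realType) (F : finFieldType) (L : fieldExtType F) (m : nat) :
  #|F| = 2%N -> (2 <= m)%N -> \dim {:L} = m ->
  density R L (m - 1) m 2 =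
    1 / 2 *
    ((2 ^+ (m ^ 2) * (totient m)%:R
        * (\prod_(1 <= j < m.+1) (1 - 1 / 2 ^+ j)) * (2 ^+ (2 * m) - 1))
     / ((2 ^+ (m ^ 2) - 1) * (2 ^+ (m ^ 2 - m) - 1))).
Proof.
case: m => // n cardF; rewrite ltnS => n_gt0 dimL; rewrite /density subn1 /=.
have GLE := card_GL2_prod R cardF (isT : 0 < n.+1)%N.
rewrite [2 ^+ _ * _]mulrC -[_ * _ * \prod_(_ <= _ < _) _]mulrA -GLE.
set p := totient n.+1.
have cardK := cardK cardF dimL.
have := card_mrd_mul cardF dimL n_gt0; have := gaussian_binomial2 (finvect_type L) n.+1.
rewrite /mrd -/p; set G := #|('GL_n.+1[F])%g|; set N := #|_|; set B := gaussian_binomial _ _ _.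
rewrite cardK; set q := (2 ^ n.+1)%N; pose b := (2 ^ (n.+1 ^ 2 - n.+1))%N.
have q_gt1 : (1 < q)%N by rewrite -[1%N](expn0 2) ltn_exp2l.
have b_gt1 : (1 < b)%N.
  by rewrite -[1%N](expn0 2) ltn_exp2l // subn_gt0 -[X in (X < _)%N]expn1 ltn_exp2l.
have qn : (q ^ n.+1 = q * b)%N.
  by rewrite /q /b -expnM -expnD mulnn subnKC // -mulnn leq_pmulr.
rewrite qn => /(congr1 (fun k => k%:R : R)) E2 /(congr1 (fun k => k%:R : R)) E1.
have -> : (2 : R) ^+ (n.+1 ^ 2) = q%:R * b%:R.
  by rewrite -natrM -qn /q -expnM mulnn natrX.
have -> : (2 : R) ^+ (n.+1 ^ 2 - n.+1) = b%:R by rewrite /b natrX.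
have -> : (2 : R) ^+ (2 * n.+1) = q%:R ^+ 2 by rewrite /q natrX -exprM mulnC.
have bqR : (1 < q%:R :> R) /\ (1 < b%:R :> R) by rewrite !ltr1n.
move: E1 E2 bqR; clearbody q b; rewrite !natrM !natrB ?natrX ?natrM //; try nia.
exact: density_arith.
Qed.

(** * Asymptotic upper bound *)

Lemma density_arith_le (R : realFieldType) (k t p q b : R) :
  0 <= p <= 1 -> 0 <= t -> t <= k -> 2 ^+ 2 <= q -> 2 <= b ->
  1 / 2 * (q * b * t * p * (q ^+ 2 - 1) / ((q * b - 1) * (b - 1)))
    <= 2 * (k * (q ^+ 2 / b)).
Proof.
move=> /andP[p0 p1] t0 tk q4 b2.
have [q0 b0] : 0 < q /\ 0 < b by split; lra.
have [qn0 bn0] : q != 0 /\ b != 0 by rewrite !gt_eqF.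
(* Each factor of the denominator is at least half its leading term; the resulting 4 times the
   leading 1/2 is the constant 2. *)
have Y0 : 0 < q * b * b / 4 by rewrite divr_gt0 ?mulr_gt0.
have leY : q * b * b / 4 <= (q * b - 1) * (b - 1).
  have -> : q * b * b / 4 = (q * b / 2) * (b / 2) by field.
  have qb : 2 <= q * b by nra.
  by apply: ler_pM; lra.
have leX : q * b * t * p * (q ^+ 2 - 1) <= q * b * k * q ^+ 2.
  have qb0 : 0 <= q * b by rewrite mulr_ge0 // ltW.
  have tp : t * p <= k by nra.
  rewrite -!mulrA !ler_pM2l // mulrA; apply: ler_pM => //; first by rewrite mulr_ge0.
    by nra.
  by lra.
have -> : 2 * (k * (q ^+ 2 / b)) = 1 / 2 * (q * b * k * q ^+ 2 / (q * b * b / 4)).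
  by field; rewrite qn0 bn0.
rewrite ler_pM2l; last by lra.
apply: ler_pM => //.
- by rewrite !mulr_ge0 ?(ltW q0) ?(ltW b0) //; nra.
- by rewrite invr_ge0; apply: le_trans leY; apply: ltW.
- by rewrite lef_pV2 ?posrE // (lt_le_trans Y0).
Qed.

Lemma density_mrd_le (R : realType) (F : finFieldType) (L : fieldExtType F) (m : nat) :
  #|F| = 2%N -> (2 <= m)%N -> \dim {:L} = m ->
  0 <= density R L (m - 1) m 2 <= 2 * (m%:R * 2 ^ (- m%:Z ^+ 2 + 3 * m%:Z)).
Proof.
move=> cardF m_ge2 dimL; apply/andP; split; first by rewrite divr_ge0.
rewrite density_mrd //; set p := \prod_(_ <= _ < _) _.
have p01 : 0 <= p <= 1.
  rewrite /p; elim/big_rec: _ => [|j x _ /andP[x0 x1]]; first by rewrite lexx ler01.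
  have h0 : 0 <= 1 - 1 / 2 ^+ j :> R.
    by rewrite subr_ge0 ler_pdivrMr ?exprn_gt0 // mul1r exprn_ege1 // ler1n.
  have h1 : 1 - 1 / 2 ^+ j <= 1 :> R by rewrite gerBl divr_ge0.
  by rewrite mulr_ge0 //= mulr_ile1.
have tm : (totient m <= m)%N.
  rewrite totient_count_coprime; apply: (@leq_trans (\sum_(0 <= d < m) 1)).
    by apply: leq_sum => i _; apply: leq_b1.
  by rewrite sum_nat_const_nat muln1 subn0.
(* This is [q ^+ 2 / b]; the natural subtraction is exact because [m <= m ^ 2]. *)
have -> : 2 ^ (- m%:Z ^+ 2 + 3 * m%:Z) = 2 ^+ (2 * m) / 2 ^+ (m ^ 2 - m) :> R.
  have -> : - m%:Z ^+ 2 + 3 * m%:Z = (2 * m)%:Z - (m ^ 2 - m)%:Z.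
    by rewrite -subzn ?PoszM -?mulnn ?leq_pmulr ?PoszM 1?ltnW //; ring.
  by rewrite expfzDr ?pnatr_eq0 // -invr_expz -!exprnP.
have -> : (2 : R) ^+ (m ^ 2) = 2 ^+ m * 2 ^+ (m ^ 2 - m).
  by rewrite -exprD subnKC // -mulnn leq_pmulr // ltnW.
have q_ge4 : 2 ^+ 2 <= 2 ^+ m :> R by rewrite ler_weXn2l // ler1n.
have b_ge2 : 2 <= 2 ^+ (m ^ 2 - m) :> R.
  rewrite -[X in X <= _]expr1 ler_weXn2l ?ler1n // subn_gt0 -[X in (X < _)%N]expn1.
  by rewrite ltn_exp2l.
have q2 : (2 : R) ^+ (2 * m) = (2 ^+ m) ^+ 2 by rewrite -exprM mulnC.
rewrite q2; move: tm; rewrite -(ler_nat R).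
move: (totient m)%:R (ler0n R (totient m)) (m%:R : R) => t t0 k tk.
move: (2 ^+ m) (2 ^+ (m ^ 2 - m)) q_ge4 b_ge2 => q b q4 b2.
exact: density_arith_le.
Qed.

Local Open Scope classical_set_scope.

Lemma density_mrd_bigO (R : realType) (F : finFieldType) (L : nat -> fieldExtType F) :
  #|F| = 2%N -> (forall m : nat, (2 <= m)%N -> \dim {:L m} = m) ->
  (fun m : nat => density R (L m) (m - 1) m 2 : R^o)
    =O_\oo
  (fun m : nat => m%:R * 2 ^ (- m%:Z ^+ 2 + 3 * m%:Z) : R^o).
Proof.
move=> cardF dimL; apply/eqO_exP; exists 2 => //.
exists 2%N => // m /= m_ge2.
have /andP[d0 d_le] := density_mrd_le R cardF m_ge2 (dimL m m_ge2).
by rewrite (ger0_norm d0) (le_trans d_le) // ler_wpM2l // ler_norm.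
Qed.

Theorem corollary4p3 (R : realType) (F : finFieldType) (hF : #|F| = 2%N) :
  (forall (m : nat) (L : fieldExtType F), (2 <= m)%N -> \dim {:L} = m ->
     density R L (m - 1) m 2 =
       1 / 2 *
       ((2 ^+ (m ^ 2) * (totient m)%:R
           * (\prod_(1 <= j < m.+1) (1 - 1 / 2 ^+ j)) * (2 ^+ (2 * m) - 1))
        / ((2 ^+ (m ^ 2) - 1) * (2 ^+ (m ^ 2 - m) - 1))))
  /\
  (forall L : nat -> fieldExtType F,
     (forall m : nat, (2 <= m)%N -> \dim {:L m} = m) ->
     (fun m : nat => density R (L m) (m - 1) m 2 : R^o)
       =O_\oo
     (fun m : nat => m%:R * 2 ^ (- m%:Z ^+ 2 + 3 * m%:Z) : R^o)).
Proof.
split=> [m L m_ge2 dimL | L dimL]; first exact: density_mrd.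
exact: density_mrd_bigO.
Qed.
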